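(* For every natural number $p\ge 8$, the group $G=BS(1,p)=\langle a,t\mid tat^{-1}=a^{p}\rangle$ with generating set $A=\{a^{\pm1},t^{\pm1}\}$ does not admit a 1-combing (of the Cayley complex of this presentation) with radial tameness function of the form $\rho(q)=q+C$ for any constant $C$.
   Context: Let $X$ be the Cayley 2-complex of the presentation $\langle a,t\mid tat^{-1}=a^p\rangle$, with $X^0=G$, $X^1$ the Cayley graph over $A$, and $\epsilon$ the identity vertex. Levels: for $g\in X^0$, $\mathrm{lev}(g)$ is the word length of $g$ over $A$; for $x$ in the interior of an edge with endpoints $g,h$, $\mathrm{lev}(x)=\frac{\mathrm{lev}(g)+\mathrm{lev}(h)}{2}+\frac14$; for $x$ in the interior of a 2-cell with boundary vertices $g_1,\dots,g_n$, $\mathrm{lev}(x)=\frac{1}{n}\sum\mathrm{lev}(g_i)+\frac14+\frac1c$ with $c=4(p+3)+1$ (four times the relator length, plus one). A 1-combing is a continuous $\Psi:X^1\times[0,1]\to X$ with $\Psi(x,0)=\epsilon$, $\Psi(x,1)=x$ for all $x\in X^1$, and $\Psi(X^0\times[0,1])\subseteq X^1$. A function $\rho:\mathbb{Q}\to\mathbb{R}_+$ is a radial tameness function for $\Psi$ if for all $x\in X^1$, $0\le s<t\le1$, $q\in\mathbb{Q}$, $\mathrm{lev}(\Psi(x,s))>\rho(q)$ implies $\mathrm{lev}(\Psi(x,t))>q$. *)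

(* Defs.v *)
From HB Require Import structures.
From mathcomp Require Import all_boot all_order all_algebra.
From mathcomp Require Import all_classical all_reals all_analysis.
Import numFieldTopology.Exports numFieldNormedType.Exports.
Set Implicit Arguments. Unset Strict Implicit. Unset Printing Implicit Defensive.
Import Order.TTheory GRing.Theory Num.Theory.
Local Open Scope classical_set_scope.
Local Open Scope ring_scope.

(** * The group BS(1,p) = < a, t | t a t^-1 = a^p >
   Realised (standard fact) as the subgroup of the affine group of Q generated
   by a : x |-> x + 1 and t : x |-> p x.  The affine map x |-> p^k x + b is
   encoded as the pair (k, b).  Right multiplication by a generator:
     (k,b) * a^{+-1} = (k, b +- p^k),   (k,b) * t^{+-1} = (k +- 1, b). *)

Inductive gen := Ga | Gt.
(* a letter of the alphabet A = {a, a^-1, t, t^-1}: (generator, positive?) *)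
Definition letter := (gen * bool)%type.

Definition gstep (p : nat) (x : int * rat) (l : letter) : int * rat :=
  match l with
  | (Ga, true)  => (x.1, x.2 + (p%:R : rat) ^ x.1)
  | (Ga, false) => (x.1, x.2 - (p%:R : rat) ^ x.1)
  | (Gt, true)  => (x.1 + 1, x.2)
  | (Gt, false) => (x.1 - 1, x.2)
  end.

Definition evalw (p : nat) (w : seq letter) : int * rat := foldl (gstep p) (0, 0) w.

Record BS (p : nat) := MkBS { bsval : int * rat ; bsP : exists w, evalw p w = bsval }.

Lemma bsmul_subproof p (g : BS p) (l : letter) :
  exists w, evalw p w = gstep p (bsval g) l.
Proof. case: g => x [w wx] /=; exists (rcons w l); by rewrite /evalw foldl_rcons -/(evalw p w) wx. Qed.

Definition bsmul p (g : BS p) (l : letter) : BS p := MkBS (bsmul_subproof g l).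
Definition bsmulw p (g : BS p) (w : seq letter) : BS p := foldl (@bsmul p) g w.

Definition bs1 p : BS p := @MkBS p (0, 0) (ex_intro _ [::] erefl).

Lemma wordlen_subproof p (g : BS p) :
  exists n, `[< exists w, size w = n /\ evalw p w = bsval g >].
Proof. case: g => x [w wx] /=; exists (size w); apply/asboolP; by exists w. Qed.

Definition wordlen p (g : BS p) : nat := ex_minn (wordlen_subproof g).

Definition relator (p : nat) : seq letter :=
  [:: (Gt, true); (Ga, true); (Gt, false)] ++ nseq p (Ga, false).

(** * The Cayley 2-complex X of the presentation.
   Points: vertices g; interior points of the edge from g to g s (s in {a,t}),
   parametrised by u in (0,1); interior points of the 2-cell attached along
   the relator loop based at g, parametrised by the open square (0,1)^2. *)

Definition in01 (R : realType) (u : R) : bool := (0 < u) && (u < 1).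
Definition inSq (R : realType) (z : R * R) : bool := in01 z.1 && in01 z.2.

Inductive X (R : realType) (p : nat) :=
| XV of BS p
| XE of BS p & gen & {u : R | in01 u}
| XF of BS p & {z : R * R | inSq z}.

Arguments XV {R p}.
Arguments XE {R p}.
Arguments XF {R p}.

HB.instance Definition _ (R : realType) (p : nat) := gen_eqMixin (X R p).
HB.instance Definition _ (R : realType) (p : nat) := gen_choiceMixin (X R p).

Section Complex.
Variables (R : realType) (p : nat).
Local Notation X := (X R p).
Local Notation BS := (BS p).

(* characteristic map of the closed edge (g, g s), on [0,1] *)
Definition echar (g : BS) (s : gen) (u : R) : X :=
  match insub u with
  | Some v => XE g s v
  | None => if u <= 2^-1 then XV g else XV (bsmul g (s, true))
  end.

Definition ncell : nat := (p + 3)%N.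

(* perimeter parameter in [0,1) of a point of the boundary of [0,1]^2,
   going counterclockwise from (0,0) *)
Definition perim (z : R * R) : R :=
  if z.2 == 0 then z.1 / 4
  else if z.1 == 1 then (1 + z.2) / 4
  else if z.2 == 1 then (3 - z.1) / 4
  else (4 - z.2) / 4.

Definition relpoint (g : BS) (j : nat) (lam : R) : X :=
  let v := bsmulw g (take j (relator p)) in
  match nth (Ga, true) (relator p) j with
  | (s, true) => echar v s lam
  | (s, false) => echar (bsmul v (s, false)) s (1 - lam)
  end.

(* characteristic map of the 2-cell at g, on the closed square [0,1]^2:
   the boundary is sent along the relator loop t a t^-1 a^-p based at g *)
Definition fchar (g : BS) (z : R * R) : X :=
  match insub z with
  | Some w => XF g w
  | None =>
      let th := (ncell%:R * perim z) in
      let j := Num.truncn th in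
      relpoint g j (th - j%:R)
  end.

Definition inI (u : R) : bool := (0 <= u) && (u <= 1).
Definition inQ (z : R * R) : bool := inI z.1 && inI z.2.

(* CW (weak) topology: U is open iff its preimage under every
   characteristic map is open in the corresponding closed cell *)
Definition Xopen (U : set X) : Prop :=
  (forall g s u, inI u -> U (echar g s u) ->
     \forall v \near u, inI v -> U (echar g s v)) /\
  (forall g z, inQ z -> U (fchar g z) ->
     \forall w \near z, inQ w -> U (fchar g w)).

Lemma XopenT : Xopen setT.
Proof. by split=> [g s u _ _|g z _ _]; apply: filterE. Qed.

Lemma XopenI : setI_closed Xopen.
Proof.
move=> A B [A1 A2] [B1 B2]; split.
- move=> g s u Iu [Au Bu].
  by apply: filterS2 (A1 _ _ _ Iu Au) (B1 _ _ _ Iu Bu) => v HA HB Iv; split;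
    [exact: HA | exact: HB].
- move=> g z Iz [Az Bz].
  by apply: filterS2 (A2 _ _ Iz Az) (B2 _ _ Iz Bz) => v HA HB Iv; split;
    [exact: HA | exact: HB].
Qed.

Lemma XopenU (I : Type) (f : I -> set X) :
  (forall i, Xopen (f i)) -> Xopen (\bigcup_i f i).
Proof.
move=> fo; split.
- move=> g s u Iu [i _ Hf]; case: (fo i) => O1 _.
  by apply: filterS (O1 _ _ _ Iu Hf) => v H /H fv; exists i.
- move=> g z Iz [i _ Hf]; case: (fo i) => _ O2.
  by apply: filterS (O2 _ _ Iz Hf) => v H /H fv; exists i.
Qed.

HB.instance Definition _ := isOpenTopological.Build X XopenT XopenI XopenU.

Definition wl (g : BS) : R := (wordlen g)%:R.

Definition cconst : R := (4 * ncell + 1)%N%:R.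

Definition lev (x : X) : R :=
  match x with
  | XV g => wl g
  | XE g s _ => (wl g + wl (bsmul g (s, true))) / 2 + 4^-1
  | XF g _ => (\sum_(j < ncell) wl (bsmulw g (take j (relator p)))) / ncell%:R
              + 4^-1 + cconst^-1
  end.

Definition inX1 (x : X) : Prop := if x is XF _ _ then False else True.
Definition inX0 (x : X) : Prop := if x is XV _ then True else False.

Definition combdom : set (X * R) := [set xt | inX1 xt.1 /\ inI xt.2].

(* 1-combing: Psi is only relevant on X^1 x [0,1] *)
Definition one_combing (Psi : X * R -> X) : Prop :=
  [/\ {within combdom, continuous Psi},
      (forall x, inX1 x -> Psi (x, 0) = XV (bs1 p)),
      (forall x, inX1 x -> Psi (x, 1) = x) &
      (forall x t, inX0 x -> inI t -> inX1 (Psi (x, t)))].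

Definition radial_tameness (Psi : X * R -> X) (rho : rat -> R) : Prop :=
  forall (x : X) (s t : R) (q : rat), inX1 x -> 0 <= s -> s < t -> t <= 1 ->
    lev (Psi (x, s)) > rho q -> lev (Psi (x, t)) > ratr q.

End Complex.

(* Main.v *)
Require Import Defs.
From HB Require Import structures.
From mathcomp Require Import all_boot all_order all_algebra.
From mathcomp Require Import all_classical all_reals all_analysis.
From mathcomp Require Import ring lra zify.
Import numFieldTopology.Exports numFieldNormedType.Exports.
Import Order.TTheory GRing.Theory Num.Theory.
Set Implicit Arguments. Unset Strict Implicit. Unset Printing Implicit Defensive.
Local Open Scope classical_set_scope.
Local Open Scope ring_scope.

(** Radial tameness [q + C] forces the combing paths of the points of level at
   most [L] to stay below level about [L + C].  Take the two paths
   [t^n a t^-n a] and [a t^n a t^-n] from the identity to [(0, p^n + 1)], of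
   length [2n + 2].  The disc they bound is made of two sheets glued along the
   line of height 0, so it contains the cell at [a^m] for every multiple [m] of
   [p] in [0, p^n[.  The combing sweeps out such a disc, hence meets this cell:
   otherwise an integer 1-cochain whose coboundary is supported by the cell
   would define a map from the complement of the cell to the circle R / Z along
   which the combing contracts the loop, although the cochain takes distinct
   values on the two paths.  But if the base-[p] digits of [m] are all equal to
   3, the word length of [a^m] is at least about [3 (p - 1) / p * n], and
   [3 (p - 1) / p > 2] as [p >= 8]. *)

(** * The circle R / Z and Coons patches *)

(** The representative in [-1/2, 1/2) of a class of R / Z; those of successive increments add up to
    the turning of a discretised path. *)
Definition frac_sym (F : archiRealFieldType) (x : F) : F :=
  x - (Num.floor (x + 2^-1))%:~R.

Definition dist_int (F : archiRealFieldType) (x : F) : F := `|frac_sym x|.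

Section DistInt.
Variable F : archiRealFieldType.
Implicit Types (x y : F) (m : int).

Lemma frac_sym_itv x : - 2^-1 <= frac_sym x < 2^-1.
Proof.
have := floor_itv (x + 2^-1); rewrite rmorphD /frac_sym; set k := _%:~R.
by move=> /andP[h1 h2]; apply/andP; split; lra.
Qed.

Lemma frac_symDz x m : frac_sym (x + m%:~R) = frac_sym x.
Proof.
have := floor_itv (x + 2^-1); rewrite rmorphD /= => /andP[h1 h2].
rewrite /frac_sym (@floor_def _ _ (Num.floor (x + 2^-1) + m)) ?rmorphD /=; first by ring.
by apply/andP; split; lra.
Qed.

Lemma frac_sym_small x : `|x| < 2^-1 -> frac_sym x = x.
Proof.
rewrite ltr_norml => /andP[h1 h2]; rewrite /frac_sym.
by rewrite (@floor_def _ _ 0) ?subr0 // add0r; apply/andP; split; lra.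
Qed.

Lemma frac_symP x : exists m, x = frac_sym x + m%:~R.
Proof. by exists (Num.floor (x + 2^-1)); rewrite subrK. Qed.

Lemma frac_symD x y : dist_int x < 4^-1 -> dist_int y < 4^-1 ->
  frac_sym (x + y) = frac_sym x + frac_sym y.
Proof.
move=> xs ys; have [m xE] := frac_symP x; have [k yE] := frac_symP y.
rewrite {1}xE {1}yE addrACA -rmorphD frac_symDz frac_sym_small //.
by apply: le_lt_trans (ler_normD _ _) _; move: xs ys; rewrite /dist_int; lra.
Qed.

Lemma dist_intDz x m : dist_int (x + m%:~R) = dist_int x.
Proof. by rewrite /dist_int frac_symDz. Qed.

Lemma dist_int_int m : dist_int (m%:~R : F) = 0.
Proof.
by rewrite -[m%:~R]add0r dist_intDz /dist_int frac_sym_small normr0 // invr_gt0.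
Qed.

Lemma dist_int0 : dist_int (0 : F) = 0. Proof. exact: (dist_int_int 0). Qed.

Lemma dist_int_le x m : dist_int x <= `|x - m%:~R|.
Proof.
rewrite -(dist_intDz x (- m)) mulrNz; move: (x - _) => y.
have [/frac_sym_small|h] := ltP `|y| 2^-1; first by rewrite /dist_int => ->.
apply: le_trans h; rewrite ler_norml; have /andP[] := frac_sym_itv y.
by move=> -> /ltW.
Qed.

Lemma dist_int_le_norm x : dist_int x <= `|x|.
Proof. by have := dist_int_le x 0; rewrite subr0. Qed.

Lemma dist_int_lip x y : dist_int x <= dist_int y + `|x - y|.
Proof.
have [m ym] := frac_symP y.
apply: (le_trans (dist_int_le x m)).
have -> : x - m%:~R = frac_sym y + (x - y) by rewrite {2}ym; ring.
exact: ler_normD.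
Qed.

Lemma dist_intN x : dist_int (- x) = dist_int x.
Proof.
suff h y : dist_int (- y) <= dist_int y by apply/eqP; rewrite eq_le h -{1}[x]opprK h.
have [m yE] := frac_symP y; apply: (le_trans (dist_int_le _ (- m))).
by rewrite {1}yE rmorphN /= opprD opprK subrK normrN.
Qed.

Lemma dist_intD x y : dist_int (x + y) <= dist_int x + dist_int y.
Proof.
have [m xE] := frac_symP x; have [k yE] := frac_symP y.
apply: (le_trans (dist_int_le _ (m + k))).
have -> : x + y - (m + k)%:~R = frac_sym x + frac_sym y.
  by rewrite {1}xE {1}yE rmorphD /=; ring.
exact: ler_normD.
Qed.

(** Discrete homotopy invariance on the circle: in each small square, both ways to the opposite
    corner give the representative of the diagonal increment, and the sum over all squares
    telescopes in either direction. *)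
Lemma frac_sym_grid (g : nat -> nat -> F) n :
  (forall i j, (i < n)%N -> (j <= n)%N -> dist_int (g i.+1 j - g i j) < 4^-1) ->
  (forall i j, (i <= n)%N -> (j < n)%N -> dist_int (g i j.+1 - g i j) < 4^-1) ->
  \sum_(0 <= i < n) frac_sym (g i.+1 n - g i n) -
  \sum_(0 <= i < n) frac_sym (g i.+1 0 - g i 0) =
  \sum_(0 <= j < n) frac_sym (g n j.+1 - g n j) -
  \sum_(0 <= j < n) frac_sym (g 0 j.+1 - g 0 j).
Proof.
move=> hH hV.
pose H i j := frac_sym (g i.+1 j - g i j).
pose V j i := frac_sym (g i j.+1 - g i j).
transitivity (\sum_(0 <= i < n) \sum_(0 <= j < n) (H i j.+1 - H i j)).
  by rewrite -sumrB; apply: eq_bigr => i _; rewrite telescope_sumr.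
rewrite exchange_big /=.
transitivity (\sum_(0 <= j < n) \sum_(0 <= i < n) (V j i.+1 - V j i)); last first.
  by rewrite -sumrB; apply: eq_bigr => j _; rewrite telescope_sumr.
apply: eq_big_nat => j /= jn; apply: eq_big_nat => i /= ni.
rewrite /H /V.
have h1 := @frac_symD (g i.+1 j - g i j) (g i.+1 j.+1 - g i.+1 j).
have h2 := @frac_symD (g i j.+1 - g i j) (g i.+1 j.+1 - g i j.+1).
have e1 : g i.+1 j - g i j + (g i.+1 j.+1 - g i.+1 j) =
  g i j.+1 - g i j + (g i.+1 j.+1 - g i j.+1) by ring.
have {}h1 := h1 (hH _ _ ni (ltnW jn)) (hV _ _ ni jn).
have {}h2 := h2 (hV _ _ (ltnW ni) jn) (hH _ _ ni jn).
move: h1 h2; rewrite e1 => -> h; lra.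
Qed.

End DistInt.

Lemma dist_int_continuous (R : realType) : continuous (@dist_int R).
Proof.
move=> x; apply/cvgrPdist_lt => e e0; near=> y.
have xy : `|x - y| < e by near: y; exact: cvgr_dist_lt.
apply: le_lt_trans xy; rewrite ler_norml.
have := dist_int_lip x y; have := dist_int_lip y x; rewrite (distrC y); lra.
Unshelve. all: by end_near. Qed.

Section Coons.
Variable R : realType.
Implicit Types (f : R -> R) (N : R) (z : R * R).

(* Coons patch: extends to the square the function [f (N * perim z)] given
   on its boundary; the correction term is bilinear in the corner values. *)
Definition coons f N z : R :=
  (1 - z.2) * f (N * (z.1 / 4)) + z.2 * f (N * ((3 - z.1) / 4)) +
  (1 - z.1) * f (N * ((4 - z.2) / 4)) + z.1 * f (N * ((1 + z.2) / 4)) -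
  ((1 - z.1) * (1 - z.2) * f 0 + z.1 * (1 - z.2) * f (N * (1 / 4)) +
   z.1 * z.2 * f (N * (2 / 4)) + (1 - z.1) * z.2 * f (N * (3 / 4))).

(** On each side, the two adjacent side terms reduce to corner values and cancel with the
    correction; [f N = f 0] makes the left and bottom sides agree at the origin. *)
Lemma coons_boundary f N z : f N = f 0 -> inQ z -> ~~ inSq z ->
  coons f N z = f (N * perim z).
Proof.
case: z => x y fN; rewrite /inQ /inI /inSq /in01 /perim /coons /=.
move=> /andP[/andP[x0 x1] /andP[y0 y1]] nb.
have f4 : f (N * (4 / 4)) = f 0 by rewrite divff ?mulr1 // pnatr_eq0.
case: eqP => [->|/eqP yn0].
  by rewrite !mul0r !subr0 !addr0 f4; ring.
case: eqP => [->|/eqP xn1].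
  by rewrite (_ : 3 - 1 = 2 :> R); [ring|lra].
case: eqP => [->|/eqP yn1].
  rewrite (_ : 4 - 1 = 3 :> R); last lra.
  by rewrite (_ : 1 + 1 = 2 :> R); [ring|lra].
have -> : x = 0.
  move: nb; rewrite !lt_neqAle x0 x1 y0 y1 xn1 yn1 !andbT (eq_sym 0 y) yn0 andbT.
  by rewrite negbK => /eqP <-.
by rewrite !mul0r !mulr0 !subr0; ring.
Qed.

Lemma perim_itv z : inQ z -> ~~ inSq z -> 0 <= perim z < 1.
Proof.
case: z => x y; rewrite /inQ /inI /inSq /in01 /perim /=.
move=> /andP[/andP[x0 x1] /andP[y0 y1]] nb.
case: eqP => [_|/eqP yn0]; first by apply/andP; split; lra.
case: eqP => [_|/eqP xn1]; first by apply/andP; split; lra.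
case: eqP => [_|/eqP yn1]; first by apply/andP; split; lra.
have ? : 0 < y by rewrite lt_neqAle y0 eq_sym yn0.
by apply/andP; split; lra.
Qed.

Lemma coons_continuous f N : continuous f -> continuous (coons f N).
Proof.
move=> cf.
have c1 : continuous (fun w : R * R => w.1) by move=> z; exact: cvg_fst.
have c2 : continuous (fun w : R * R => w.2) by move=> z; exact: cvg_snd.
have cc (a : R) : continuous (fun _ : R * R => a) by move=> z; exact: cvg_cst.
have cD (h k : R * R -> R) : continuous h -> continuous k ->
  continuous (fun w => h w + k w) by move=> ch ck z; exact: (cvgD (ch z) (ck z)).
have cM (h k : R * R -> R) : continuous h -> continuous k ->
  continuous (fun w => h w * k w) by move=> ch ck z; exact: (cvgM (ch z) (ck z)).
have cN (h : R * R -> R) : continuous h -> continuous (fun w => - h w).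
  by move=> ch z; exact: (cvgN (ch z)).
have cF (h : R * R -> R) : continuous h -> continuous (fun w => f (h w)).
  by move=> ch z; exact: (@continuous_comp _ _ _ h f z (ch z) (cf (h z))).
rewrite /coons.
repeat lazymatch goal with
| |- continuous (fun w => @?h w + @?k w) => refine (cD _ _ _ _)
| |- continuous (fun w => - @?h w) => refine (cN _ _)
| |- continuous (fun w => @?h w * @?k w) => refine (cM _ _ _ _)
| |- continuous (fun w => f (@?h w)) => refine (cF _ _)
| |- continuous fst => exact: c1
| |- continuous snd => exact: c2
| |- _ => exact: cc
end.
Qed.

End Coons.

(** * Uniform continuity modulo integers on the closed square *)

Section Grid.
Variable R : realType.
Implicit Types (c : R * R -> R) (N i j : nat).

Lemma inQ_compact : compact [set z : R * R | inQ z]%classic.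
Proof.
have -> : [set z : R * R | inQ z]%classic = (`[0, 1] `*` `[0, 1])%classic.
  by apply/seteqP; split=> [[x y] /andP[/= h1 h2]|[x y] [/=]];
     rewrite /= ?in_itv //= => h1 h2; apply/andP.
by apply: compact_setX; exact: segment_compact.
Qed.

Lemma mod1_unif_continuous c (e : R) : 0 < e ->
  (forall z, inQ z -> forall e : R, 0 < e ->
     \forall w \near z, inQ w -> dist_int (c w - c z) < e) ->
  \forall N \near \oo, forall z w, inQ z -> inQ w ->
     `|z.1 - w.1| <= N.+1%:R^-1 -> `|z.2 - w.2| <= N.+1%:R^-1 ->
     dist_int (c w - c z) < e.
Proof.
move=> e0 cc.
have /compact_near_coveringP/(_ nat \oo%classic (fun N z => inQ z -> forall w, inQ w ->
     `|z.1 - w.1| <= N.+1%:R^-1 -> `|z.2 - w.2| <= N.+1%:R^-1 ->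
     dist_int (c w - c z) < e)) := inQ_compact.
move=> h; have {}h := h _ _.
apply: filterS (h _ _) => [N H z w Qz Qw zw1 zw2|]; first exact: H.
move=> z Qz.
have e2 : 0 < e / 2 by lra.
have /nbhs_ballP[d /= d0 dP] := cc z Qz _ e2.
have d2 : 0 < d / 2 by lra.
near=> z' N => Qz' w Qw zw1 zw2 /=.
have zz' : ball z (d / 2) z' by near: z'; exact: (nbhsx_ballx z (d / 2) d2).
have Nd : N.+1%:R^-1 < d / 2 by near: N; exact: near_infty_natSinv_lt (PosNum d2).
have h1 : dist_int (c z' - c z) < e / 2.
  by apply: dP Qz'; apply: le_ball zz'; lra.
have h2 : dist_int (c w - c z) < e / 2.
  apply: dP Qw; rewrite (_ : d = d / 2 + d / 2); last lra.
  apply: ball_triangle zz' _.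
  by split; apply: le_lt_trans Nd.
have -> : c w - c z' = (c w - c z) - (c z' - c z) by ring.
by apply: (le_lt_trans (dist_intD _ _)); rewrite dist_intN; lra.
Unshelve. all: by end_near. Qed.

End Grid.

(** * Integer cochains as circle-valued maps *)

Section Cochain.
Variables (R : realType) (p : nat) (phi : BS p -> gen -> int).
Implicit Types (g h v : BS p) (s : gen) (l : letter) (w : seq letter).

(** A negative letter runs backwards along the edge based at its end [bsmul v l]. *)
Definition letter_sum v l : int :=
  if l.2 then phi v l.1 else - phi (bsmul v l) l.1.

Fixpoint path_sum v w : int :=
  if w is l :: w' then letter_sum v l + path_sum (bsmul v l) w' else 0.

Local Notation rel_sum h j :=
  (letter_sum (bsmulw h (take j (relator p))) (nth (Ga, true) (relator p) j)).

Lemma path_sum_big v w : path_sum v w =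
  \sum_(j < size w) letter_sum (bsmulw v (take j w)) (nth (Ga, true) w j).
Proof.
elim: w v => [|l w IH] v /=; first by rewrite big_ord0.
by rewrite big_ord_recl IH.
Qed.

(* The truncation of [x] to [0, 1]. *)
Definition clamp (x : R) : R := (`|x| - `|x - 1| + 1) / 2.

Lemma clamp_le0 x : x <= 0 -> clamp x = 0.
Proof. by move=> x0; rewrite /clamp !ler0_norm; lra. Qed.

Lemma clamp_ge1 x : 1 <= x -> clamp x = 1.
Proof. by move=> x1; rewrite /clamp !ger0_norm; lra. Qed.

Lemma clamp_id x : inI x -> clamp x = x.
Proof. by move=> /andP[x0 x1]; rewrite /clamp ger0_norm ?ler0_norm; lra. Qed.

Lemma clamp_continuous : continuous clamp.
Proof.
move=> x; apply: cvgM; last exact: cvg_cst.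
apply: cvgD; last exact: cvg_cst.
apply: cvgB; first exact: norm_continuous.
by apply: cvg_norm; apply: cvgB; [exact: cvg_id | exact: cvg_cst].
Qed.

(* Lift to R of the loop on which the boundary of the cell at [h] is sent by
   the cochain; each letter has length 1. *)
Definition boundary_lift h (x : R) : R :=
  \sum_(j < ncell p) (rel_sum h j)%:~R * clamp (x - j%:R).

Lemma size_relator : size (relator p) = ncell p.
Proof. by rewrite /= size_nseq /ncell addnC. Qed.

Lemma boundary_lift0 h : boundary_lift h 0 = 0.
Proof.
by rewrite /boundary_lift big1 // => j _; rewrite clamp_le0 ?mulr0// sub0r oppr_le0.
Qed.

Lemma boundary_lift_end h :
  boundary_lift h (ncell p)%:R = (path_sum h (relator p))%:~R.
Proof.
rewrite path_sum_big size_relator raddf_sum /=; apply: eq_bigr => j _.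
by rewrite clamp_ge1 ?mulr1 // -natrB ?ler1n ?subn_gt0 // ltnW.
Qed.

Lemma boundary_lift_continuous h : continuous (boundary_lift h).
Proof.
apply: continuous_big => [|j _ x]; first exact: add_continuous.
have cj : {for x, continuous (fun y : R => y - j%:R)}.
  by apply: cvgB; [exact: cvg_id | exact: cvg_cst].
exact: (cvgM (cvg_cst _) (continuous_comp cj (@clamp_continuous _))).
Qed.

Lemma boundary_lift_letter h j (u : R) : (j < ncell p)%N -> inI u ->
  exists m : int, boundary_lift h (j%:R + u) = (rel_sum h j)%:~R * u + m%:~R.
Proof.
move=> jN /andP[u0 u1].
(* The letters before [j] are complete and contribute integers; those after [j] have not begun. *)
exists (\sum_(i < ncell p | (i < j)%N) rel_sum h i).
rewrite /boundary_lift (bigID (fun i : 'I_ _ => (i < j)%N)) /= addrC; congr (_ + _).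
  rewrite (bigD1 (Ordinal jN)) /= ?ltnn // [X in _ + X]big1.
    by rewrite addr0 addrAC subrr add0r clamp_id // /inI u0.
  move=> i; rewrite -leqNgt -val_eqE /= => /andP[ji ij].
  have {ji ij}: (j < i)%N by rewrite ltn_neqAle eq_sym ij.
  rewrite -(ler_nat R) -natr1 => ji.
  by rewrite clamp_le0 ?mulr0 //; lra.
rewrite raddf_sum /=; apply: eq_bigr => i; rewrite -(ler_nat R) -natr1 => ij.
by rewrite clamp_ge1 ?mulr1 //; lra.
Qed.

(* The cochain as a map to the circle R / Z: only the class of [theta x]
   modulo integers is meaningful. *)
Definition theta (x : X R p) : R :=
  match x with
  | XV _ => 0
  | XE h s u => val u * (phi h s)%:~R
  | XF h z => coons (boundary_lift h) (ncell p)%:R (val z)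
  end.

Lemma echar0 h s : echar h s 0 = XV h :> X R p.
Proof. by rewrite /echar insubF ?invr_ge0 ?ler0n // /in01 ltxx. Qed.

Lemma echar1 h s : echar h s 1 = XV (bsmul h (s, true)) :> X R p.
Proof.
rewrite /echar insubF ?/in01 ?ltxx ?andbF //; case: ifP => //.
by move=> h1; exfalso; lra.
Qed.

Lemma inX1_echar h s (u : R) : inX1 (echar h s u : X R p).
Proof. by rewrite /echar; case: insubP => //= _; case: ifP. Qed.

Lemma inX1_relpoint h j (u : R) : inX1 (relpoint h j u : X R p).
Proof. by rewrite /relpoint; case: nth => s []; exact: inX1_echar. Qed.

Lemma theta_echar h s u : inI u ->
  exists m : int, theta (echar h s u) = u * (phi h s)%:~R + m%:~R.
Proof.
move=> /andP[u0 u1].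
move: u0; rewrite le_eqVlt => /predU1P[<-|u0].
  by exists 0; rewrite echar0 mul0r addr0.
move: u1; rewrite le_eqVlt => /predU1P[->|u1].
  by exists (- phi h s); rewrite echar1 /= rmorphN /=; ring.
exists 0; rewrite /echar; case: insubP => [v _ <-|] /=; first by rewrite addr0.
by rewrite /in01 u0 u1.
Qed.

Lemma theta_relpoint h j u : (j < ncell p)%N -> inI u ->
  exists m : int, theta (relpoint h j u) = boundary_lift h (j%:R + u) + m%:~R.
Proof.
move=> jN uI; have [k ->] := boundary_lift_letter h jN uI.
rewrite /relpoint /letter_sum; case: nth => s [] /=.
  have [m ->] := theta_echar (bsmulw h (take j (relator p))) s uI.
  by exists (m - k); rewrite rmorphB /=; ring.
(* A negative letter has parameter [1 - u] on its edge, which only shifts the lift by an integer. *)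
have uI' : inI (1 - u) by move: uI => /andP[? ?]; apply/andP; split; lra.
have [m ->] := theta_echar (bsmul (bsmulw h (take j (relator p))) (s, false)) s uI'.
set f := phi _ _.
by exists (m - k + f); rewrite rmorphD rmorphB rmorphN /=; ring.
Qed.

Lemma theta_fchar_boundary h z : inQ z -> ~~ inSq z ->
  exists m : int, theta (fchar h z) =
    boundary_lift h ((ncell p)%:R * perim z) + m%:~R.
Proof.
move=> Qz nz; have /andP[z0 z1] := perim_itv Qz nz.
rewrite /fchar insubN //; set th := _ * _.
have th0 : 0 <= th by rewrite mulr_ge0.
have /andP[j0 j1] := truncn_itv th0; set j := Num.truncn th in j0 j1 *.
have jN : (j < ncell p)%N.
  rewrite -(ltr_nat R); apply: le_lt_trans j0 _.
  by rewrite /th gtr_pMr // ltr0n /ncell addnS.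
have uI : inI (th - j%:R) by move: j1; rewrite -natr1 => ?; apply/andP; split; lra.
have [m ->] := theta_relpoint h jN uI.
by exists m; rewrite [_ + (th - _)]addrC subrK.
Qed.

(** The path sum is the obstruction to closing the lift of the boundary loop; when it vanishes, the
    Coons patch extends the map over the cell. *)
Lemma theta_fchar h z : inQ z -> path_sum h (relator p) = 0 ->
  exists m : int, theta (fchar h z) =
    coons (boundary_lift h) (ncell p)%:R z + m%:~R.
Proof.
move=> Qz h0; have [Sz|nSz] := boolP (inSq z).
  by exists 0; rewrite /fchar insubT /= addr0.
rewrite coons_boundary //; first exact: theta_fchar_boundary.
by rewrite boundary_lift_end h0 boundary_lift0.
Qed.

Definition in_cell g (x : X R p) : Prop := if x is XF h _ then h = g else False.

Lemma in_cell_inX1 g (x : X R p) : in_cell g x -> ~ inX1 x.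
Proof. by case: x => [? []|? ? ? []|? ? _ []]. Qed.

Lemma inSq_near z : inSq z -> \forall w \near z, @inSq R w.
Proof.
move=> /andP[/andP[a1 a2] /andP[b1 b2]].
near=> w; rewrite /inSq /in01; apply/andP; split; apply/andP; split; near: w.
- exact: (cvgr_gt _ (@cvg_fst _ _ _ _ _)).
- exact: (cvgr_lt _ (@cvg_fst _ _ _ _ _)).
- exact: (cvgr_gt _ (@cvg_snd _ _ _ _ _)).
- exact: (cvgr_lt _ (@cvg_snd _ _ _ _ _)).
Unshelve. all: by end_near. Qed.

End Cochain.

(** * Combings that avoid a cell *)

Section Combing.
Variables (R : realType) (p : nat) (phi : BS p -> gen -> int) (g : BS p).
Implicit Types (h v : BS p) (s : gen) (z w : R * R).
Local Notation theta := (@theta R p phi).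
Local Notation boundary_lift := (@boundary_lift R p phi).

Hypothesis phi_cocycle : forall h, h <> g -> path_sum phi h (relator p) = 0.

Lemma near_dist_int_lt (T : topologicalType) (F : T -> R) (c e : R) (t : T) :
  {for t, continuous F} -> dist_int (F t - c) < e ->
  \forall u \near t, dist_int (F u - c) < e.
Proof.
move=> cF Fte.
have d0 : 0 < e - dist_int (F t - c) by rewrite subr_gt0.
near=> u.
have h : `|F t - F u| < e - dist_int (F t - c).
  by near: u; move: d0; apply: cvgr_dist_lt; exact: cF.
apply: le_lt_trans (dist_int_lip _ (F t - c)) _.
rewrite -ltrBrDl; apply: le_lt_trans h.
by rewrite distrC opprB addrA subrK.
Unshelve. all: by end_near. Qed.

(** Continuity of [theta] modulo integers off the open cell at [g]; adjoining the whole cell yields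
    an open set of the complex without control of [theta] inside it. *)
Lemma theta_open (c e : R) :
  open [set y | in_cell g y \/ dist_int (theta y - c) < e].
Proof.
split=> [h s u uI | h z Qz] /=.
  case=> [/in_cell_inX1/(_ (inX1_echar _ _ _)) //|ue].
  have cF : {for u, continuous (fun v : R => v * (phi h s)%:~R)}.
    by apply: cvgM; [exact: cvg_id | exact: cvg_cst].
  have eqF (x : R) : inI x -> dist_int (theta (echar h s x) - c) =
      dist_int (x * (phi h s)%:~R - c).
    by move=> /(theta_echar phi h s)[m ->]; rewrite addrAC dist_intDz.
  rewrite eqF // in ue.
  by apply: filterS (near_dist_int_lt cF ue) => v ve vI; right; rewrite eqF.
have [->|/eqP hg] := eqVneq (h : {classic _}) g; last first.
  have cF : {for z, continuous (coons (boundary_lift h) (ncell p)%:R)}.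
    exact/coons_continuous/boundary_lift_continuous.
  have eqF (w : R * R) : inQ w -> dist_int (theta (fchar h w) - c) =
      dist_int (coons (boundary_lift h) (ncell p)%:R w - c).
    move=> Qw; have [m ->] := theta_fchar Qw (phi_cocycle hg).
    by rewrite addrAC dist_intDz.
  case=> [|ze].
    rewrite /fchar; case: insubP => [? _ _ /hg //|_].
    by move=> /in_cell_inX1/(_ (inX1_relpoint _ _ _)).
  rewrite eqF // in ze.
  by apply: filterS (near_dist_int_lt cF ze) => w we Qw; right; rewrite eqF.
have incell (w : R * R) : inSq w -> in_cell g (fchar g w).
  by move=> Sw; rewrite /fchar insubT.
have [/inSq_near Sz _|nSz] := boolP (inSq z).
  by apply: filterS Sz => w /incell; left.
case=> [|ze].
  by rewrite /fchar insubN // => /in_cell_inX1/(_ (inX1_relpoint _ _ _)).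
(* The lift of the boundary of [g] does not close up, but its distance to
   [c + Z] does. *)
pose f x := dist_int (boundary_lift g x - c).
have cf : continuous f.
  move=> x; apply: (@continuous_comp _ _ _ (fun x => boundary_lift g x - c)).
    by apply: cvgB; [exact: boundary_lift_continuous | exact: cvg_cst].
  exact: dist_int_continuous.
have fN : f (ncell p)%:R = f 0.
  rewrite /f boundary_lift_end boundary_lift0.
  by rewrite -[(path_sum _ _ _)%:~R]add0r addrAC dist_intDz.
have eqF (w : R * R) : inQ w -> ~~ inSq w -> dist_int (theta (fchar g w) - c) =
    coons f (ncell p)%:R w.
  move=> Qw nSw; rewrite coons_boundary // /f.
  by have [m ->] := theta_fchar_boundary phi g Qw nSw; rewrite addrAC dist_intDz.
rewrite eqF // in ze.
have cz : coons f (ncell p)%:R w @[w --> z] --> coons f (ncell p)%:R z.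
  exact: coons_continuous.
apply: filterS (cvgr_lt _ cz _ ze) => w we Qw.
by have [/incell|nSw] := boolP (inSq w); [left | right; rewrite eqF].
Qed.

Variable Psi : X R p * R -> X R p.
Hypothesis Psi_comb : one_combing Psi.

Lemma comb_near_theta h s z (e : R) : inQ z -> 0 < e ->
  \forall w \near z, inQ w -> in_cell g (Psi (echar h s w.1, w.2)) \/
    dist_int (theta (Psi (echar h s w.1, w.2)) -
              theta (Psi (echar h s z.1, z.2))) < e.
Proof.
move=> Qz e0; case: Psi_comb => /subspace_continuousP cPsi _ _ _.
have /andP[Iz1 Iz2] := Qz.
have dz : combdom (echar h s z.1 : X R p, z.2) by split=> //=; exact: inX1_echar.
set y := Psi _ in cPsi *.
have : nbhs y [set x | in_cell g x \/ dist_int (theta x - theta y) < e].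
  apply: open_nbhs_nbhs; split; first exact: theta_open.
  by right; rewrite subrr dist_int0.
move=> /(cPsi _ dz) [[A B] /= [nA nB] AB].
move: nA; rewrite nbhsE => -[V [[oV _] Vz] VA].
have z1 : \forall w \near z, inI w.1 -> V (echar h s w.1).
  by apply: (@cvg_fst _ _ _ _ _ _ (oV _ _ _ Iz1 Vz)).
have z2 : \forall w \near z, B w.2 by exact: (@cvg_snd _ _ _ _ _ _ nB).
apply: filterS2 z1 z2 => w wV wB Qw; have /andP[Iw1 Iw2] := Qw.
apply: (AB (_, _)) => /=; first by split=> //; exact: VA (wV Iw1).
by split=> //=; exact: inX1_echar.
Qed.

(* The total turning in R / Z of the discretised combing path of [v]. *)
Definition turning (N : nat) v : R :=
  \sum_(0 <= j < N.+1) frac_sym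
    (theta (Psi (XV v, j.+1%:R / N.+1%:R)) - theta (Psi (XV v, j%:R / N.+1%:R))).

(** The grid identity on the square edge by time. At time 0 the combing is constant; at time 1 it is
    the edge itself, along which [theta] advances by [phi h s] in equal steps; the other two sides
    are the turnings of the endpoints. *)
Lemma edge_turning h s :
  (forall u t : R, inI u -> inI t -> ~ in_cell g (Psi (echar h s u, t))) ->
  \forall N \near \oo, (phi h s)%:~R = turning N (bsmul h (s, true)) - turning N h.
Proof.
move=> avoid; case: (Psi_comb) => _ Psi0 Psi1 _.
pose c z := theta (Psi (echar h s z.1, z.2)).
have cc z : inQ z -> forall e : R, 0 < e ->
    \forall w \near z, inQ w -> dist_int (c w - c z) < e.
  move=> Qz e e0; apply: filterS (comb_near_theta h s Qz e0) => w H Qw.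
  by case: (H Qw) => // /avoid; case; case/andP: Qw.
have e4 : (0 : R) < 4^-1 by rewrite invr_gt0.
(* This mesh keeps the steps [phi h s / N.+1] below 1/4, hence equal to their representatives; the
   added 1 covers [phi h s = 0]. *)
have b0 : (0 : R) < 4^-1 / (`|(phi h s)%:~R| + 1) by rewrite divr_gt0 // ltr_wpDl.
near=> N.
have Nc : forall z w, inQ z -> inQ w ->
     `|z.1 - w.1| <= N.+1%:R^-1 -> `|z.2 - w.2| <= N.+1%:R^-1 ->
     dist_int (c w - c z) < 4^-1.
  by near: N; exact: mod1_unif_continuous.
have Nb : N.+1%:R^-1 < 4^-1 / (`|(phi h s)%:~R| + 1) :> R.
  by near: N; exact: near_infty_natSinv_lt (PosNum b0).
have n0 : (0 : R) < N.+1%:R by [].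
have ph : `|(phi h s)%:~R / N.+1%:R| < 4^-1 :> R.
  rewrite normrM normfV [`|N.+1%:R|]ger0_norm //.
  rewrite ltr_pdivlMr ?ltr_wpDl // mulrC in Nb; apply: le_lt_trans Nb.
  by rewrite ler_pM2r ?invr_gt0 // lerDl.
have QI i j : (i <= N.+1)%N -> (j <= N.+1)%N ->
    inQ (i%:R / N.+1%:R, j%:R / N.+1%:R : R).
  by move=> iN jN; rewrite /inQ /inI /= !divr_ge0 //= !ler_pdivrMr // !mul1r !ler_nat iN.
have step i : `|i%:R / N.+1%:R - i.+1%:R / N.+1%:R| <= N.+1%:R^-1 :> R.
  rewrite -mulrBl -natr1 opprD addrA subrr add0r mulN1r normrN.
  by rewrite ger0_norm ?invr_ge0.
have st0 (x : R) : `|x - x| <= N.+1%:R^-1 by rewrite subrr normr0 invr_ge0.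
pose G i j := c (i%:R / N.+1%:R, j%:R / N.+1%:R).
have gH i j : (i < N.+1)%N -> (j <= N.+1)%N -> dist_int (G i.+1 j - G i j) < 4^-1.
  by move=> iN jN; apply: Nc; rewrite ?QI //= ltnW.
have gV i j : (i <= N.+1)%N -> (j < N.+1)%N -> dist_int (G i j.+1 - G i j) < 4^-1.
  by move=> iN jN; apply: Nc; rewrite ?QI //= ltnW.
have := frac_sym_grid gH gV.
have n1 : N.+1%:R / N.+1%:R = 1 :> R by rewrite divff ?lt0r_neq0.
rewrite /G /c /= n1 !mul0r echar0 echar1 => <-.
rewrite [X in _ - X]big1 ?subr0; last first.
  move=> i _; rewrite !Psi0; [|exact: inX1_echar..].
  by rewrite subrr frac_sym_small // normr0 invr_gt0.
rewrite (eq_big_nat _ _ (F2 := fun=> (phi h s)%:~R / N.+1%:R)); last first.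
  move=> i /= iN; rewrite !Psi1; [|exact: inX1_echar..].
  have I1 : inI (i%:R / N.+1%:R : R) by have /andP[] := QI _ _ (ltnW iN) (ltnW iN).
  have I2 : inI (i.+1%:R / N.+1%:R : R) by have /andP[] := QI _ _ iN iN.
  have [m ->] := theta_echar phi h s I2; have [k ->] := theta_echar phi h s I1.
  set f := _%:~R in ph *.
  rewrite (_ : _ - _ = f / N.+1%:R + (m - k)%:~R); last first.
    by rewrite -[i.+1%:R]natr1 rmorphB /=; move: N.+1%:R^-1 => M; ring.
  by rewrite frac_symDz frac_sym_small //; apply: lt_trans ph _; lra.
by rewrite sumr_const_nat subn0 -[_ *+ _]mulr_natr divfK ?lt0r_neq0.
Unshelve. all: by end_near. Qed.

End Combing.

(** * The group BS(1,p) *)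

Section Group.
Variable p : nat.
Hypothesis p_ge8 : (8 <= p)%N.
Implicit Types (g h v : BS p) (s : gen) (l : letter) (w : seq letter).

Lemma BS_inj g h : bsval g = bsval h -> g = h.
Proof.
by case: g h => [x Px] [y Py] /= xy; subst y; congr MkBS; exact: Prop_irrelevance.
Qed.

Lemma bsmulw_cat v w w' : bsmulw v (w ++ w') = bsmulw (bsmulw v w) w'.
Proof. by rewrite /bsmulw foldl_cat. Qed.

Lemma bsval_bsmulw v w : bsval (bsmulw v w) = foldl (gstep p) (bsval v) w.
Proof. by elim: w v => //= l w IH v; rewrite IH. Qed.

Lemma bsmulNK v s : bsmul (bsmul v (s, false)) (s, true) = v.
Proof.
apply: BS_inj; case: v => [[k b] /= _]; case: s => /=.
  by rewrite subrK.
by rewrite subrK.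
Qed.

Lemma wordlen1 : wordlen (bs1 p) = 0%N.
Proof.
apply/eqP; rewrite -leqn0 /wordlen; case: ex_minnP => n _; apply.
by apply/asboolP; exists [::].
Qed.

Lemma wordlen_bsmul v l : (wordlen (bsmul v l) <= (wordlen v).+1)%N.
Proof.
rewrite /wordlen; case: ex_minnP => n _; case: ex_minnP => k /asboolP[w [<- wv]] _.
apply; apply/asboolP; exists (rcons w l); rewrite size_rcons; split=> //.
by rewrite /evalw foldl_rcons -/(evalw p w) wv.
Qed.

Lemma path_sum_cat phi v w w' :
  path_sum phi v (w ++ w') = path_sum phi v w + path_sum phi (bsmulw v w) w'.
Proof. by elim: w v => [|l w IH] v /=; rewrite ?add0r // IH addrA. Qed.

(** Adds up [edge_turning] along [w], all of whose vertices have length at most [L] by the last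
    hypothesis. *)
Lemma path_turning (R : realType) phi g (Psi : X R p * R -> X R p) (L : nat) v w :
  (forall h, h <> g -> path_sum phi h (relator p) = 0) -> one_combing Psi ->
  (forall h s (u t : R), (wordlen h <= L)%N -> (wordlen (bsmul h (s, true)) <= L)%N ->
    inI u -> inI t -> ~ in_cell g (Psi (echar h s u, t))) ->
  (wordlen v + size w <= L)%N ->
  \forall N \near \oo,
    (path_sum phi v w)%:~R = turning phi Psi N (bsmulw v w) - turning phi Psi N v.
Proof.
move=> cocycle comb avoid; elim: w v => [|l w IH] v /=.
  by move=> _; apply: filterE => N; rewrite subrr.
rewrite addnS -addSn => vwL; have vl := wordlen_bsmul v l.
have vlL : (wordlen (bsmul v l) <= L)%N.
  exact: leq_trans vl (leq_trans (leq_addr _ _) vwL).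
have vL : (wordlen v <= L)%N by apply: leq_trans (leq_trans (leq_addr _ _) vwL).
have IHv := IH (bsmul v l) (leq_trans (leq_add vl (leqnn _)) vwL).
suff lv : \forall N \near \oo, (letter_sum phi v l)%:~R =
    turning phi Psi N (bsmul v l) - turning phi Psi N v.
  by apply: filterS2 lv IHv => N h1 h2; rewrite rmorphD /= h1 h2; ring.
case: l vlL {vl IHv} => s [] vlL; rewrite /letter_sum /=.
  by apply: (edge_turning cocycle comb) => u t Iu It; exact: avoid.
have := @edge_turning _ _ phi g cocycle Psi comb (bsmul v (s, false)) s.
rewrite bsmulNK => H.
have {}H := H (fun u t Iu It => avoid _ _ _ _ vlL _ Iu It).
by apply: filterS (H _) => [N|]; rewrite ?bsmulNK // rmorphN /= => ->; rewrite opprB.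
Qed.

(** * The cochain dual to a vertical ray *)

Lemma p_gt0 : 0 < p%:R :> rat. Proof. by rewrite ltr0n; lia. Qed.
Let p_neq0 : p%:R != 0 :> rat. Proof. exact: lt0r_neq0 p_gt0. Qed.

(** Half-open convention: [step_at m b - step_at m (b + p ^ k)] is 1 exactly when
    [b <= m < b + p ^ k], so each horizontal line has a single a-edge across [m]. *)
Definition step_at (m c : rat) : int := if c <= m then 1 else 0.

(* Dual to a vertical ray going up from the top edge of the cell at (0, m), in
   all the sheets above it: counts the crossings of an a-edge with this ray. *)
Definition ray_cochain (m : rat) (x : int * rat) : int :=
  if (1 <= x.1) && ((x.2 - m) / p%:R \is a Num.int)
  then step_at m x.2 - step_at m (x.2 + p%:R ^ x.1) else 0.

Definition ray_phi (m : rat) v s : int :=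
  if s is Ga then ray_cochain m (bsval v) else 0.

Lemma int_divp_exp (c : rat) (k : int) : 1 <= k ->
  ((c - p%:R ^ k) / p%:R \is a Num.int) = (c / p%:R \is a Num.int).
Proof.
move=> k1; rewrite mulrBl rpredBr //.
case: k k1 => [[//|n]|//] _.
by rewrite -exprnP exprSr mulfK // rpredX // rpred_nat.
Qed.

Lemma path_sum_tpow m v n b :
  path_sum (ray_phi m) v (nseq n (Gt, b)) = 0.
Proof.
elim: n v => //= n IH v; rewrite IH addr0 /letter_sum.
by case: b {IH}; rewrite /= ?oppr0.
Qed.

(** On a horizontal line the cochain is zero or the coboundary of [- step_at m], so the sum
    telescopes. *)
Lemma path_sum_apow m v n k c : bsval v = (k, c) ->
  path_sum (ray_phi m) v (nseq n (Ga, false)) =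
  if (1 <= k) && ((c - m) / p%:R \is a Num.int)
  then step_at m c - step_at m (c - n%:R * p%:R ^ k) else 0.
Proof.
elim: n v c => [|n IH] v c vE /=; first by rewrite mul0r subr0 subrr if_same.
rewrite (IH (bsmul v (Ga, false)) (c - p%:R ^ k)) /= ?vE //.
rewrite /letter_sum /= /ray_cochain /= vE /=.
have [k1|//] := boolP (1 <= k).
rewrite addrAC int_divp_exp //=; case: ifP => _; last by [].
have -> : c - p%:R ^ k - n%:R * p%:R ^ k = c - n.+1%:R * p%:R ^ k.
  by rewrite -natr1; ring.
by rewrite subrK; ring.
Qed.

(** For a base at height [k >= 1], the top edge and the [p] bottom edges have equal sums; for
    [k < 0] no edge counts. For [k = 0] only the top edge, from [b] to [b + p], counts, and it meets
    the ray just for [b = m], the excluded cell. *)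
Lemma ray_phi_cocycle m g v : bsval g = (0, m) -> v <> g ->
  path_sum (ray_phi m) v (relator p) = 0.
Proof.
move=> gm vg.
have -> : relator p = [:: (Gt, true); (Ga, true); (Gt, false)] ++ nseq p (Ga, false) by [].
have : bsval v <> (0, m) by move=> vm; apply: vg; apply: BS_inj; rewrite gm.
case vE: (bsval v) => [k b] kb.
rewrite path_sum_cat (@path_sum_apow _ _ _ k (b + p%:R ^ (k + 1))); last first.
  by rewrite bsval_bsmulw vE /= addrK.
rewrite /= /letter_sum /= /ray_cochain /= vE /= oppr0 !addr0 add0r.
have pk : p%:R ^ (k + 1) = p%:R * p%:R ^ k :> rat by rewrite expfzDr // expr1z mulrC.
have cong : 1 <= k + 1 ->
    ((b + p%:R ^ (k + 1) - m) / p%:R \is a Num.int) = ((b - m) / p%:R \is a Num.int).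
  by move=> k1; rewrite -(int_divp_exp _ k1) addrAC addrK.
have -> : b + p%:R ^ (k + 1) - p%:R * p%:R ^ k = b by rewrite pk; ring.
have [k1|k1] := boolP (1 <= k).
  have k2 : 1 <= k + 1 by lia.
  by rewrite k2 cong //=; case: ifP => _ //; ring.
rewrite addr0; have [k2|//] := boolP (1 <= k + 1).
have k0 : k = 0 by lia.
move: kb pk; rewrite {}k0 add0r => kb ->; rewrite expr0z mulr1 /=.
case: ifP => //= /intrP[j jE].
have bE : b = m + j%:~R * p%:R by rewrite -jE divfK // addrC subrK.
rewrite /step_at bE; have jp : (j%:~R * p%:R <= 0 :> rat) = (j <= 0).
  by rewrite pmulr_lle0 ?p_gt0 // lerz0.
have jp1 : (j%:~R * p%:R + p%:R <= 0 :> rat) = (j + 1 <= 0).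
  by rewrite -{2}[p%:R]mul1r -mulrDl -[1]/(1%:~R) -rmorphD pmulr_lle0 ?p_gt0 // lerz0.
rewrite -addrA !gerDl jp jp1.
(* [j <= 0] and [j + 1 <= 0] disagree only at [j = 0], the cell of [g]. *)
have j0 : j != 0 by apply/eqP => j0; apply: kb; rewrite bE j0 mul0r addr0.
by case: ifP; case: ifP => //; lia.
Qed.


(** * Word length and base-[p] digits *)

(* Bounds from below the number of powers of [p] needed to write [b] as a
   signed sum: one power contributes at most [1 / (p - 1)]. *)
Definition digit_weight (n : nat) (b : rat) : rat :=
  \sum_(i < n) dist_int (b / p%:R ^+ i.+1).

Lemma digit_weightD n b c :
  digit_weight n (b + c) <= digit_weight n b + digit_weight n c.
Proof.
rewrite -big_split; apply: ler_sum => i _ /=; rewrite mulrDl; exact: dist_intD.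
Qed.

Lemma digit_weightN n b : digit_weight n (- b) = digit_weight n b.
Proof. by apply: eq_bigr => i _; rewrite mulNr dist_intN. Qed.

(** The terms with [i < k] vanish, being distances from integers to Z; the others are bounded by a
    geometric series of sum [1 / (p - 1)]. *)
Lemma digit_weight_pow n (k : int) :
  digit_weight n (p%:R ^ k) <= (p%:R - 1)^-1.
Proof.
have p1 : 0 < p%:R - 1 :> rat by rewrite subr_gt0 ltr1n; lia.
(* The added term carries the remainder of the series through the induction; it is 1 as long as
   [n <= k]. *)
suff h : (p%:R - 1) * digit_weight n (p%:R ^ k) + Num.min 1 (p%:R ^ (k - n%:Z)) <= 1.
  rewrite -[_^-1]mul1r ler_pdivlMr // mulrC; apply: le_trans h; rewrite lerDl.
  by rewrite le_min ler01 exprz_ge0 // ltW // p_gt0.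
elim: n => [|n IH]; first by rewrite /digit_weight big_ord0 mulr0 add0r ge_min lexx.
rewrite /digit_weight big_ord_recr /=; apply: le_trans IH; rewrite -/(digit_weight n _).
rewrite mulrDr -addrA lerD2l.
have -> : p%:R ^ k / p%:R ^+ n.+1 = p%:R ^ (k - n.+1%:Z) :> rat.
  by rewrite expfzDr // exprz_inv exprnP.
have -> : p%:R ^ (k - n%:Z) = p%:R * p%:R ^ (k - n.+1%:Z) :> rat.
  by rewrite -{2}[p%:R]expr1z -expfzDr //; congr (_ ^ _); lia.
have [|kn] := leP 0 (k - n.+1%:Z).
  case: (k - _) => // j _; rewrite -exprnP -natrX.
  have := @dist_int_int rat (p ^ j)%N; rewrite -pmulrn => ->.
  rewrite mulr0 add0r -natrM !(min_idPl _) // ler1n ?muln_gt0 ?expn_gt0; lia.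
set y := _ ^ _; have y0 : 0 <= y by rewrite exprz_ge0 // ltW // p_gt0.
have py : p%:R * y <= 1.
  rewrite /y -{1}[p%:R]expr1z -expfzDr // -(expr0z p%:R) ler_weXz2l ?ler1n; lia.
have y1 : y <= 1 by apply: le_trans py; rewrite ler_peMl // ler1n; lia.
have dy : dist_int y <= y by rewrite (le_trans (dist_int_le_norm _)) // ger0_norm.
rewrite !(min_idPr _) //; have := ler_wpM2l (ltW p1) dy; rewrite !mulrBl; lra.
Qed.

Lemma digit_weight_gstep n x l :
  `|digit_weight n (gstep p x l).2 - digit_weight n x.2| <= (p%:R - 1)^-1.
Proof.
have p1 : 0 < p%:R - 1 :> rat by rewrite subr_gt0 ltr1n; lia.
have W b c : digit_weight n c <= (p%:R - 1)^-1 ->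
    `|digit_weight n (b + c) - digit_weight n b| <= (p%:R - 1)^-1.
  move=> hc; have := digit_weightD n b c; have := digit_weightD n (b + c) (- c).
  by rewrite addrK digit_weightN ler_norml => h1 h2; apply/andP; split; lra.
case: l => [[] []] /=; rewrite ?subrr ?normr0 ?invr_ge0 ?(ltW p1) //.
  by apply: W; exact: digit_weight_pow.
by apply: W; rewrite digit_weightN digit_weight_pow.
Qed.

Lemma digit_weight_bsmulw n v w :
  `|digit_weight n (bsval (bsmulw v w)).2 - digit_weight n (bsval v).2| <=
  (size w)%:R / (p%:R - 1).
Proof.
rewrite bsval_bsmulw; elim: w (bsval v) => [|l w IH] x /=.
  by rewrite subrr normr0 mul0r.
apply: le_trans (ler_distD (digit_weight n (gstep p x l).2) _ _) _.
by rewrite -natr1 mulrDl mul1r lerD // digit_weight_gstep.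
Qed.

Lemma digit_weight_wordlen n v :
  digit_weight n (bsval v).2 <= (wordlen v)%:R / (p%:R - 1).
Proof.
rewrite /wordlen; case: ex_minnP => k /asboolP[w [<- wv]] _.
have := digit_weight_bsmulw n (bs1 p) w; rewrite bsval_bsmulw /= -/(evalw p w) wv.
suff -> : digit_weight n 0 = 0 by rewrite subr0; apply: le_trans; exact: ler_norm.
by apply: big1 => i _; rewrite mul0r dist_int0.
Qed.

(* The digit 3 is less than [(p - 1) / 2], hence is not worth replacing by
   [3 - p] with a carry, and [3 (p - 1) / p > 2]. *)
Definition sparse_exp n : nat := \sum_(i < n) 3 * p ^ i.+1.

(** Keeps the fractional parts below 1/2, so that [dist_int] reads them off; the induction rests on
    [1 + 2 * 3 <= p]. *)
Lemma sparse_exp_lt n : (2 * sparse_exp n < p ^ n.+1)%N.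
Proof.
elim: n => [|n IH]; first by rewrite /sparse_exp big_ord0 muln0 expn_gt0; lia.
rewrite /sparse_exp big_ord_recr /= -/(sparse_exp n) (expnS p n.+1); nia.
Qed.

Lemma sparse_exp_mod n i : (i <= n)%N ->
  exists k : nat, sparse_exp n = (sparse_exp i + k * p ^ i.+1)%N.
Proof.
elim: n => [|n IH]; first by rewrite leqn0 => /eqP ->; exists 0%N; rewrite addn0.
rewrite leq_eqVlt => /predU1P[->|iN]; first by exists 0%N; rewrite addn0.
rewrite ltnS in iN; have [k nE] := IH iN.
exists (k + 3 * p ^ (n - i))%N.
have e : (p ^ n.+1 = p ^ (n - i) * p ^ i.+1)%N by rewrite -expnD addnS subnK.
by rewrite /sparse_exp big_ord_recr /= -/(sparse_exp n) nE e mulnDl mulnA addnA.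
Qed.

(** Modulo 1, [sparse_exp n / p ^ (i + 2)] is [sparse_exp (i + 1) / p ^ (i + 2)], whose leading
    digit alone gives [3 / p]. The first term of the weight is bounded below by 0. *)
Lemma digit_weight_sparse n :
  3 * n%:R / p%:R <= digit_weight n.+1 (sparse_exp n)%:R.
Proof.
rewrite /digit_weight big_ord_recl /= -[leLHS]add0r lerD ?normr_ge0 //.
have -> : 3 * n%:R / p%:R = \sum_(i < n) (3 / p%:R : rat).
  by rewrite sumr_const card_ord -[RHS]mulr_natr; ring.
apply: ler_sum => i _; rewrite /bump /= add1n.
have [k ->] := sparse_exp_mod (ltn_ord i).
have pn0 : (0 : rat) < p%:R ^+ i.+2 by rewrite exprn_gt0 // p_gt0.
rewrite natrD natrM [in leRHS]mulrDl natrX mulfK ?lt0r_neq0 // -[k%:R]/(k%:Z%:~R) dist_intDz.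
set y := (sparse_exp _)%:R / _; have y0 : 0 <= y by rewrite divr_ge0 // ltW.
have y2 : y < 2^-1.
  have : 2 * (sparse_exp i.+1)%:R < p%:R ^+ i.+2 :> rat.
    by rewrite -natrX -natrM ltr_nat sparse_exp_lt.
  by rewrite /y ltr_pdivrMr //; lra.
rewrite /dist_int frac_sym_small ger0_norm //.
rewrite ler_pdivlMr // exprS mulrA divfK // -natrX -natrM ler_nat.
by rewrite /sparse_exp big_ord_recr /= leq_addl.
Qed.

(** For [p >= 8], [3 (p - 1) / p] is at least 21/8. The word [w] serves to reach all boundary
    vertices of the cell at [g]. *)
Lemma wordlen_near_sparse n g w : bsval g = (0, (sparse_exp n)%:R) ->
  (21 * n <= 8 * (wordlen (bsmulw g w) + size w))%N.
Proof.
move=> gE; have := digit_weight_bsmulw n.+1 g w; rewrite gE /=.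
have := digit_weight_wordlen n.+1 (bsmulw g w); have := digit_weight_sparse n.
set d := digit_weight _ _; set e := digit_weight _ _ => h1 h2.
rewrite distrC => /(le_trans (ler_norm _)) h3.
have p1 : 0 < p%:R - 1 :> rat by rewrite subr_gt0 ltr1n; lia.
have {h2 h3}: d <= ((wordlen (bsmulw g w))%:R + (size w)%:R) / (p%:R - 1).
  by rewrite mulrDl; lra.
move=> /(le_trans h1); rewrite ler_pdivlMr // mulrAC ler_pdivrMr ?p_gt0 //.
rewrite -(natrB _ (_ : 1 <= p)%N) ?(leq_trans _ p_ge8) // -natrD -!natrM ler_nat.
nia.
Qed.

(** * Separation of the two paths by the ray *)

Lemma sparse_exp_divp n : (sparse_exp n)%:R / p%:R \is a @Num.int rat.
Proof.
rewrite /sparse_exp natr_sum mulr_suml rpred_sum // => i _.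
by rewrite expnSr mulnA natrM mulfK // rpred_nat.
Qed.

(** The top edge of the arch from 0 spans [m < p ^ n.+1], in a sheet above the cell since [p]
    divides [m]. *)
Lemma ray_cochain_sparse n : ray_cochain (sparse_exp n)%:R (n.+1%:Z, 0) = 1.
Proof.
rewrite /ray_cochain /= add0r mulNr rpredN sparse_exp_divp /step_at ler0n.
rewrite add0r -exprnP -natrX ler_nat leqNgt.
by rewrite (leq_ltn_trans _ (sparse_exp_lt n)) ?leq_pmull.
Qed.

(** The arch from 1 rises into another sheet, as [1 / p] is not an integer. *)
Lemma ray_cochain_sparse1 n : ray_cochain (sparse_exp n)%:R (n.+1%:Z, 1) = 0.
Proof.
rewrite /ray_cochain /= mulrBl rpredBr ?sparse_exp_divp // mul1r; case: ifP => // /intrP[j jE].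
have p1 : (1 : rat) < p%:R by rewrite ltr1n; lia.
have : ((0 : rat) < p%:R^-1) && (p%:R^-1 < (1 : rat)).
  apply/andP; split; first by rewrite invr_gt0 p_gt0.
  by rewrite -[ltLHS]mul1r ltr_pdivrMr ?p_gt0 // mul1r.
rewrite jE ltr0z -[1]/(1%:~R) ltr_int; lia.
Qed.

Definition arch n : seq letter :=
  nseq n (Gt, true) ++ [:: (Ga, true)] ++ nseq n (Gt, false).

Lemma foldl_tpow (x : int * rat) n : foldl (gstep p) x (nseq n (Gt, true)) = (x.1 + n%:Z, x.2).
Proof.
elim: n x => [|n IH] x /=; first by rewrite addr0 -surjective_pairing.
by rewrite IH /= -addrA -intS.
Qed.

Lemma foldl_tpowN (x : int * rat) n : foldl (gstep p) x (nseq n (Gt, false)) = (x.1 - n%:Z, x.2).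
Proof.
elim: n x => [|n IH] x /=; first by rewrite subr0 -surjective_pairing.
by rewrite IH /= -addrA -opprD -intS.
Qed.

Lemma bsval_over v n b : bsval v = (0, b) ->
  bsval (bsmulw v (arch n)) = (0, b + p%:R ^+ n).
Proof.
move=> vE; rewrite bsval_bsmulw vE !foldl_cat /= foldl_tpow foldl_tpowN /=.
by rewrite !add0r subrr -exprnP.
Qed.

Lemma path_sum_over m v n b : bsval v = (0, b) ->
  path_sum (ray_phi m) v (arch n) = ray_cochain m (n%:Z, b).
Proof.
move=> vE; rewrite !path_sum_cat !path_sum_tpow /= !addr0 add0r /letter_sum /=.
by rewrite bsval_bsmulw vE foldl_tpow /= add0r.
Qed.

Lemma path_sum_a m v b : bsval v = (0, b) ->
  path_sum (ray_phi m) v [:: (Ga, true)] = 0.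
Proof. by move=> vE; rewrite /= /letter_sum /= /ray_cochain vE. Qed.

End Group.

(** * Levels and the final contradiction *)

Lemma size_arch n : size (arch n) = (2 * n + 1)%N.
Proof. by rewrite !size_cat !size_nseq /=; lia. Qed.

Lemma lev_echar_le (R : realType) p (L : nat) (h : BS p) s (u : R) :
  (wordlen h <= L)%N -> (wordlen (bsmul h (s, true)) <= L)%N ->
  lev (echar h s u) <= L%:R + 1.
Proof.
rewrite -!(ler_nat R) => h1 h2; rewrite /echar; case: insubP => [v _ _|_] /=.
  by rewrite /wl; lra.
by case: ifP => _ /=; rewrite /wl; lra.
Qed.

Lemma lev_cell_ge (R : realType) p (B : R) (g : BS p) z :
  (forall j, (j < ncell p)%N -> B <= wl R (bsmulw g (take j (relator p)))) ->
  B <= lev (XF g z : X R p).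
Proof.
move=> hB; rewrite /lev; set S := \sum_(j < _) _.
have h : B <= S / (ncell p)%:R.
  rewrite ler_pdivlMr; last by rewrite ltr0n /ncell addnS.
  have : \sum_(j < ncell p) B <= S by apply: ler_sum => j _; exact: hB.
  by rewrite sumr_const card_ord -[B *+ _]mulr_natr.
have : 0 <= (cconst R p)^-1 by rewrite invr_ge0.
by move: h; lra.
Qed.

Theorem theorem7p1 (R : realType) (p : nat) : (8 <= p)%N ->
  forall C : R, ~ exists Psi : X R p * R -> X R p,
    one_combing Psi /\ radial_tameness Psi (fun q : rat => ratr q + C).
Proof.
move=> p8 C [Psi [comb tame]].
(* [8 / 5 * D < n] amounts to [2 n + 5 + C < 21 / 8 * n - (p + 3)], where the left side is
   [L + 1 + C]. *)
set D : R := p%:R + 8 + C.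
have D0 : 0 <= 8 / 5 * `|D| by rewrite mulr_ge0.
pose n := Num.bound (8 / 5 * `|D|).
have nD : 8 / 5 * D < n%:R.
  by apply: le_lt_trans (archi_boundP D0); rewrite ler_pM2l ?ler_norm.
(* [L] is the common length of [w1] and [w2], which use [arch n.+1] because [m < p ^ n.+1]. *)
pose m := sparse_exp p n; pose L := (2 * n + 4)%N.
pose g := bsmulw (bs1 p) (nseq m (Ga, true)).
have gE : bsval g = (0, m%:R).
  suff h k b : foldl (gstep p) (0, b) (nseq k (Ga, true)) = (0, b + k%:R).
    by rewrite bsval_bsmulw h add0r.
  elim: k b => [|k IH] b /=; first by rewrite addr0.
  by rewrite expr0z IH -addrA -natr1 [1 + _]addrC.
pose phi := ray_phi (p := p) m%:R.
have cocycle h : h <> g -> path_sum phi h (relator p) = 0.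
  exact: ray_phi_cocycle.
have cell_high z : L%:R + 1 + C < lev (XF g z : X R p).
  apply: (@lt_le_trans _ _ (21 / 8 * n%:R - (p%:R + 3))).
    by rewrite /L natrD natrM; move: nD; rewrite /D; lra.
  apply: lev_cell_ge => j jN.
  have := wordlen_near_sparse p8 (take j (relator p)) gE.
  have : (size (take j (relator p)) <= p + 3)%N by rewrite size_take_min size_relator geq_minr.
  rewrite -!(ler_nat R) !natrM !natrD /wl; lra.
have avoid h s (u t : R) : (wordlen h <= L)%N -> (wordlen (bsmul h (s, true)) <= L)%N ->
    inI u -> inI t -> ~ in_cell g (Psi (echar h s u, t)).
  move=> h1 h2 Iu /andP[t0 t1]; have lx := lev_echar_le u h1 h2.
  set x : X R p := echar h s u in lx *.
  have x1 : inX1 x by exact: inX1_echar.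
  have Px := match comb with And4 _ _ P _ => P end x x1.
  case E: (Psi (x, t)) => [?|? ? ?|h' z] hg; [by []|by []|rewrite {}hg in E].
  move: t1; rewrite le_eqVlt => /predU1P[t1|t1].
    by move: E; rewrite t1 Px => E; move: x1; rewrite E.
  (* Once the combing path of [x] meets the cell, tameness with [q = L + 1] puts [x] itself above
     level [L + 1]. *)
  have := tame x t 1 (L.+1)%:R x1 t0 t1 (lexx _).
  rewrite E Px ratr_nat -natr1 => /(_ (cell_high z)) /lt_le_trans/(_ lx).
  by rewrite ltxx.
have pt := path_turning cocycle comb avoid.
pose w1 := arch n.+1 ++ [:: (Ga, true)]; pose w2 := [:: (Ga, true)] ++ arch n.+1.
have w1L : (wordlen (bs1 p) + size w1 <= L)%N.
  by rewrite wordlen1 size_cat size_arch /= /L; lia.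
have w2L : (wordlen (bs1 p) + size w2 <= L)%N.
  by rewrite wordlen1 size_cat size_arch /= /L; lia.
have aE : bsval (bsmulw (bs1 p) [:: (Ga, true)]) = (0, 1) by [].
have oE := @bsval_over p (bs1 p) n.+1 0 erefl.
have w12 : bsmulw (bs1 p) w1 = bsmulw (bs1 p) w2.
  apply: BS_inj; rewrite [in RHS]bsmulw_cat (bsval_over _ aE) bsmulw_cat /= oE /=.
  by rewrite add0r addrC.
have s1 : path_sum phi (bs1 p) w1 = 1.
  rewrite path_sum_cat (path_sum_a _ oE) addr0 (path_sum_over _ _ (b := 0)) //.
  exact: ray_cochain_sparse.
have s2 : path_sum phi (bs1 p) w2 = 0.
  by rewrite path_sum_cat (path_sum_over _ _ aE) ray_cochain_sparse1.
(* For a common mesh [N], both path sums equal the same difference of turnings, as the endpoints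
   coincide: [1 = 0]. *)
have [N [e1 e2]] := filter_ex (filterI (pt _ _ w1L) (pt _ _ w2L)).
by move: e1 e2; rewrite w12 s1 s2 => <- /eqP; rewrite eqr_int.
Qed.
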